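(* Let $\beta>\alpha>0$, $\rho=\alpha/\beta<1$, and let $L\ge1$ be an integer. Let $0<\theta<1$ when $L\ge2$, or $\rho\le\theta<1$ when $L=1$. There exist $\gamma_\theta>0$ and $C_\theta<\infty$ such that, for every $z_0\in L_2(g_\theta)$, the solution $z_t=\mathrm e^{\mathcal Kt}z_0$ of $\dot z_t=\mathcal Kz_t$ in $L_2(g_\theta)$ satisfies $$\|z_t\|_{L_2(g_\theta)}\le\mathrm e^{-\gamma_\theta t}C_\theta\|z_0\|_{L_2(g_\theta)},\qquad t\ge0.$$
   Context: $g_\theta=(\theta^k)_{k\ge1}$ and $L_2(g_\theta)=\{x\in\mathbb R^{\mathbb N}:x(0)=0,\ \|x\|^2_{L_2(g_\theta)}=\sum_{k\ge1}x(k)^2\theta^{-k}<\infty\}$. $\mathcal K$ acts on sequences $x$ with $x(0)=0$ by $\mathcal Kx(0)=0$ and $\mathcal Kx(k)=\beta L\rho^{L^{k-1}}x(k-1)-(\beta L\rho^{L^k}+\beta)x(k)+\beta x(k+1)$, $k\ge1$; it is a bounded operator in $L_2(g_\theta)$. *)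

(* Defs.v *)
From HB Require Import structures.
From mathcomp Require Import all_boot all_order all_algebra.
From mathcomp Require Import all_classical all_reals all_analysis.

Set Implicit Arguments.
Unset Strict Implicit.
Unset Printing Implicit Defensive.

Import Order.TTheory GRing.Theory Num.Theory.
Import numFieldNormedType.Exports.

Local Open Scope classical_set_scope.
Local Open Scope ring_scope.

Definition L2g_sqnorm (R : realType) (theta : R) (x : nat -> R) : \bar R :=
  (\sum_(1 <= k <oo) (x k ^+ 2 * theta ^- k)%:E)%E.

Definition L2g (R : realType) (theta : R) : set (nat -> R) :=
  [set x | x 0%N = 0 /\ (L2g_sqnorm theta x < +oo)%E].

(* Since [fine +oo = 0], this is the norm only for [x] in [L2g theta]. *)
Definition L2g_norm (R : realType) (theta : R) (x : nat -> R) : R :=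
  Num.sqrt (fine (L2g_sqnorm theta x)).

Definition L2g_cvg (R : realType) (theta : R)
    (u : nat -> nat -> R) (l : nat -> R) : Prop :=
  [/\ forall n, L2g theta (u n), L2g theta l
    & L2g_norm theta (fun k => u n k - l k) @[n --> \oo] --> (0 : R)].

Definition calK (R : realType) (beta rho : R) (L : nat) (x : nat -> R)
    (k : nat) : R :=
  if k is j.+1 then
    beta * L%:R * rho ^+ (L ^ j) * x j
    - (beta * L%:R * rho ^+ (L ^ k) + beta) * x k
    + beta * x k.+1
  else 0.

(* [y = e^{At} x], the exponential series being summed in L_2(g_theta). *)
Definition is_L2g_exp (R : realType) (theta : R)
    (A : (nat -> R) -> nat -> R) (t : R) (x y : nat -> R) : Prop :=
  L2g_cvg theta (fun N k => \sum_(n < N) t ^+ n / n`!%:R * iter n A x k) y.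

(* [z] solves dz_t/dt = A z_t on [0, +oo[, the derivative being the limit of
   difference quotients in the norm of L_2(g_theta), one-sided at t = 0.
   The values of [z] at negative times are irrelevant. *)
Definition is_L2g_solution (R : realType) (theta : R)
    (A : (nat -> R) -> nat -> R) (z0 : nat -> R) (z : R -> nat -> R) : Prop :=
  [/\ z 0 = z0,
      forall t, 0 <= t -> L2g theta (z t) /\ L2g theta (A (z t))
    & forall t, 0 <= t ->
        L2g_norm theta (fun k => (z s k - z t k) / (s - t) - A (z t) k)
          @[s --> within [set s | 0 <= s] t^'] --> (0 : R)].

(* Main.v *)
(* Let a_k be the coefficient of x(k) in (Kx)(k+1), so that K is the forward
   operator of a birth-death chain with birth rates a_k and death rate beta,
   killed at 0.  If phi, psi > 0 satisfy K phi <= - gam phi and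
   K^* psi <= - gam psi, then by 2uv <= u^2 + v^2 the operator K + gam is
   dissipative for the weight psi / phi (Schur test).  For L >= 2 the rates a_k
   vanish at infinity, and phi, psi can be chosen comparable to
   theta^(k/2), theta^(-k/2), so that psi / phi gives a norm equivalent to that
   of L_2(g_theta); for L = 1 these powers themselves work.

   In the weighted norm a short Euler step x + h K x contracts by
   1 - gam h / 2, and real induction on t turns this into exponential decay of
   every differentiable solution; applied to a difference of two solutions it
   also yields uniqueness.  The exponential series is differentiated term by
   term: the error of the difference quotient has coefficients of constant sign
   on [0, +oo[, hence is dominated by that of the scalar function
   exp (t |K|). *)

Require Import Defs.
From HB Require Import structures.
From mathcomp Require Import all_boot all_order all_algebra.
From mathcomp Require Import all_classical all_reals all_analysis.
From mathcomp Require Import ring lra.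

Set Implicit Arguments.
Unset Strict Implicit.
Unset Printing Implicit Defensive.

Import Order.TTheory GRing.Theory Num.Theory.
Import numFieldNormedType.Exports.

Local Open Scope classical_set_scope.
Local Open Scope ring_scope.

(* [r] bounds the norm of [x]; quantifying over finite sums keeps infinite
   series out of the triangle inequality and of pointwise limits. *)
Definition bounded_by (R : realType) (w : nat -> R) (x : nat -> R) (r : R) :=
  [/\ x 0%N = 0, 0 <= r
    & forall N, \sum_(1 <= k < N) x k ^+ 2 * w k <= r ^+ 2].

(** * Norm bounds for weighted square-summable sequences *)

Section BoundedBy.
Variables (R : realType) (w : nat -> R).
Hypothesis w_gt0 : forall k, (0 < k)%N -> 0 < w k.
Implicit Types (x y : nat -> R) (r q : R).

Lemma bounded_by_le x r q : r <= q -> bounded_by w x r -> bounded_by w x q.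
Proof.
move=> rq [x0 r0 xr]; split => //; first exact: le_trans rq.
move=> N; apply: (le_trans (xr N)).
by rewrite ler_sqr ?nnegrE // (le_trans r0).
Qed.

(** Fatou-type principle: a partial sum has finitely many terms, so coordinatewise convergence of
    [u] suffices to pass its bound to the limit. *)
Lemma bounded_by_lim (T : topologicalType) (F : set_system T)
    (FF : ProperFilter F) (u : T -> nat -> R) (q : T -> R) x r :
  (forall k, u i k @[i --> F] --> x k) -> q i @[i --> F] --> r ->
  (\forall i \near F, bounded_by w (u i) (q i)) -> bounded_by w x r.
Proof.
move=> ux qr uq; split.
- have h : (0 : R) @[i --> F] --> x 0%N.
    apply: cvg_trans (ux 0%N); apply: near_eq_cvg.
    by apply: filterS uq => i [].
  by apply: (cvg_unique _ h); [exact: norm_hausdorff|exact: cvg_cst].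
- by apply: (ler_cvg_to (cvg_cst 0) qr); apply: filterS uq => i [].
- move=> N; apply: (@ler_cvg_to _ F _ _ (fun i => \sum_(1 <= k < N) u i k ^+ 2 * w k)
                     (fun i => q i ^+ 2)).
  + apply: cvg_big => [|k _]; first exact: add_continuous.
    by apply: cvgMr_tmp; apply: cvgM; exact: ux.
  + by apply: cvgM.
  + by apply: filterS uq => i [].
Qed.

Lemma bounded_by_cst_lim (T : topologicalType) (F : set_system T)
    (FF : ProperFilter F) (q : T -> R) x r :
  q i @[i --> F] --> r ->
  (\forall i \near F, bounded_by w x (q i)) -> bounded_by w x r.
Proof. by apply: bounded_by_lim => k; exact: cvg_cst. Qed.

Lemma bounded_by_ge x r :
  (forall q, r < q -> bounded_by w x q) -> bounded_by w x r.
Proof.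
move=> h; apply: (@bounded_by_cst_lim _ (at_right r) _ id).
  by apply: cvg_at_right_filter; exact: cvg_id.
by near=> q; apply: h.
Unshelve. all: by end_near. Qed.

Lemma bounded_by_add x y r q : bounded_by w x r -> bounded_by w y q ->
  bounded_by w (fun k => x k + y k) (r + q).
Proof.
move=> xr yq.
(* The identity below divides by both radii. General radii are reached by enlarging each by half of
   the gap to [p]. *)
suff pos r' q' : 0 < r' -> 0 < q' -> bounded_by w x r' -> bounded_by w y q' ->
    bounded_by w (fun k => x k + y k) (r' + q').
  apply: bounded_by_ge => p rqp.
  have -> : p = (r + (p - (r + q)) / 2) + (q + (p - (r + q)) / 2) by field.
  have p0 : 0 < (p - (r + q)) / 2 by lra.
  have [_ r0 _] := xr; have [_ q0 _] := yq.
  apply: pos; [lra|lra| |].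
    by apply: bounded_by_le xr; rewrite lerDl ltW.
  by apply: bounded_by_le yq; rewrite lerDl ltW.
move=> {}r0 {}q0 {xr}[x0 _ xr] {yq}[y0 _ yq]; split.
- by rewrite x0 y0 addr0.
- by rewrite addr_ge0 ?ltW.
move=> N.
(* [(x+y)^2 <= (1+q/r) x^2 + (1+r/q) y^2] gives Minkowski without
   Cauchy-Schwarz *)
apply: (@le_trans _ _ ((1 + q' / r') * (\sum_(1 <= k < N) x k ^+ 2 * w k)
   + (1 + r' / q') * (\sum_(1 <= k < N) y k ^+ 2 * w k))).
  rewrite !mulr_sumr -big_split /= !big_seq; apply: ler_sum => k.
  rewrite mem_index_iota => /andP[k0 _].
  rewrite mulrA [_ * (y k ^+ 2 * _)]mulrA -mulrDl ler_wpM2r ?(ltW (w_gt0 k0)) // -subr_ge0.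
  have -> : (1 + q' / r') * x k ^+ 2 + (1 + r' / q') * y k ^+ 2 - (x k + y k) ^+ 2
     = (q' * x k - r' * y k) ^+ 2 / (r' * q') by field; rewrite !gt_eqF.
  by rewrite divr_ge0 ?sqr_ge0 // mulr_ge0 ?ltW.
have -> : (r' + q') ^+ 2 = (1 + q' / r') * r' ^+ 2 + (1 + r' / q') * q' ^+ 2.
  by field; rewrite !gt_eqF.
by apply: lerD; apply: ler_wpM2l => //; rewrite addr_ge0 ?divr_ge0 ?ltW.
Qed.

Lemma bounded_by_scale c x r :
  bounded_by w x r -> bounded_by w (fun k => c * x k) (`|c| * r).
Proof.
move=> [x0 r0 xr]; split; [by rewrite x0 mulr0|exact: mulr_ge0|move=> N].
rewrite exprMn real_normK ?num_real //.
under eq_bigr do rewrite exprMn -mulrA.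
by rewrite -mulr_sumr ler_wpM2l ?sqr_ge0.
Qed.

Lemma bounded_by_sub x y r q : bounded_by w x r -> bounded_by w y q ->
  bounded_by w (fun k => x k - y k) (r + q).
Proof.
move=> xr /(bounded_by_scale (-1)); rewrite normrN1 mul1r => yq.
rewrite (_ : (fun k => _) = fun k => x k + -1 * y k).
  exact: bounded_by_add.
by apply/funext => k; rewrite mulN1r.
Qed.

Lemma bounded_by0 : bounded_by w (fun=> 0) 0.
Proof. by split => // N; rewrite big1 ?sqr_ge0 // => k _; rewrite expr0n mul0r. Qed.

Lemma bounded_by_sum (I : Type) (s : seq I) (u : I -> nat -> R) (q : I -> R) :
  (forall i, bounded_by w (u i) (q i)) ->
  bounded_by w (fun k => \sum_(i <- s) u i k) (\sum_(i <- s) q i).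
Proof.
move=> uq; elim: s => [|i s ih].
  under eq_fun do rewrite big_nil.
  by rewrite big_nil; exact: bounded_by0.
rewrite big_cons; under eq_fun do rewrite big_cons.
exact: bounded_by_add.
Qed.

Lemma bounded_by_coord x r k : bounded_by w x r -> (0 < k)%N ->
  `|x k| <= r / Num.sqrt (w k).
Proof.
move=> [x0 r0 xr] k0; rewrite ler_pdivlMr ?sqrtr_gt0 ?w_gt0 //.
rewrite -ler_sqr ?nnegrE ?mulr_ge0 ?sqrtr_ge0 //.
rewrite exprMn real_normK ?num_real // sqr_sqrtr ?(ltW (w_gt0 k0)) //.
apply: le_trans (xr k.+1); rewrite big_nat_recr //= lerDr.
rewrite big_seq; apply: sumr_ge0 => j; rewrite mem_index_iota => /andP[j0 _].
by rewrite mulr_ge0 ?sqr_ge0 ?ltW ?w_gt0.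
Qed.

Lemma bounded_by_eq0 x : bounded_by w x 0 -> x = fun=> 0.
Proof.
move=> x0; apply/funext => -[|k]; first by have [] := x0.
by have := @bounded_by_coord x 0 k.+1 x0 isT; rewrite mul0r normr_le0 => /eqP.
Qed.

Lemma bounded_by_weight (v : nat -> R) c x r : 0 <= c ->
  (forall k, (0 < k)%N -> v k <= c ^+ 2 * w k) ->
  bounded_by w x r -> bounded_by v x (c * r).
Proof.
move=> c0 vw [x0 r0 xr]; split => //; first exact: mulr_ge0.
move=> N; apply: (@le_trans _ _ (c ^+ 2 * \sum_(1 <= k < N) x k ^+ 2 * w k)).
  rewrite mulr_sumr !big_seq; apply: ler_sum => k.
  rewrite mem_index_iota => /andP[k0 _].
  by rewrite mulrCA ler_wpM2l ?sqr_ge0 ?vw.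
by rewrite exprMn ler_wpM2l ?sqr_ge0.
Qed.

End BoundedBy.

(** * Comparison with the series defining the norm of L_2(g_theta) *)

Section L2gBounded.
Variables (R : realType) (theta : R).
Hypothesis theta_gt0 : 0 < theta.
Implicit Types (x : nat -> R) (r : R).

Let W k : R := theta ^- k.

Lemma L2g_weight_gt0 k : 0 < theta ^- k.
Proof. by rewrite invr_gt0 exprn_gt0. Qed.

Lemma L2g_sqnorm_le x r : bounded_by W x r ->
  (L2g_sqnorm theta x <= (r ^+ 2)%:E)%E.
Proof.
move=> [_ _ xr]; apply: lime_le.
  apply: is_cvg_nneseries => k _ _.
  by rewrite lee_fin mulr_ge0 ?sqr_ge0 ?ltW ?L2g_weight_gt0.
by apply: nearW => N; rewrite sumEFin lee_fin; exact: xr.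
Qed.

Lemma bounded_by_L2g x r : bounded_by W x r -> L2g theta x.
Proof.
move=> xr; split; first by case: xr.
by apply: le_lt_trans (L2g_sqnorm_le xr) _; rewrite ltry.
Qed.

Lemma L2g_sqnorm_ge0 x : (0 <= L2g_sqnorm theta x)%E.
Proof.
by apply: nneseries_ge0 => k _ _; rewrite lee_fin mulr_ge0 ?sqr_ge0 ?ltW ?L2g_weight_gt0.
Qed.

(** The bound makes the series finite, so [fine] returns its value and not the default 0. *)
Lemma L2g_norm_le x r : bounded_by W x r -> L2g_norm theta x <= r.
Proof.
move=> xr; have [_ r0 _] := xr; have [_ xfin] := bounded_by_L2g xr.
rewrite -(ger0_norm r0) -sqrtr_sqr ler_sqrt ?sqr_ge0 //.
by rewrite -lee_fin fineK ?L2g_sqnorm_le // ge0_fin_numE ?L2g_sqnorm_ge0.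
Qed.

Lemma L2g_norm_ge0 x : 0 <= L2g_norm theta x.
Proof. exact: sqrtr_ge0. Qed.

Lemma L2g_bounded_by x : L2g theta x -> bounded_by W x (L2g_norm theta x).
Proof.
move=> [x0 xfin]; split => //; first exact: sqrtr_ge0.
move=> N; rewrite sqr_sqrtr ?fine_ge0 ?L2g_sqnorm_ge0 //.
rewrite -lee_fin fineK ?ge0_fin_numE ?L2g_sqnorm_ge0 // -sumEFin.
apply: nneseries_lim_ge => k _ _.
by rewrite lee_fin mulr_ge0 ?sqr_ge0 ?ltW ?L2g_weight_gt0.
Qed.

End L2gBounded.

(** * Power series of a bounded operator, and its exponential *)

Section OperatorSeries.
Variables (R : realType) (w : nat -> R).
Hypothesis w_gt0 : forall k, (0 < k)%N -> 0 < w k.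
Variables (A : (nat -> R) -> nat -> R) (M : R).
Hypothesis A_linear : forall x c y,
  A (fun k => x k + c * y k) = fun k => A x k + c * A y k.
Hypothesis A_lim : forall (u : nat -> nat -> R) l,
  (forall k, u n k @[n --> \oo] --> l k) ->
  forall k, A (u n) k @[n --> \oo] --> A l k.
Hypothesis M_ge0 : 0 <= M.
Hypothesis A_bounded : forall x r,
  bounded_by w x r -> bounded_by w (A x) (M * r).
Implicit Types (c : nat -> R) (x : nat -> R) (r B s t : R).

Definition op_sum c N x k : R := \sum_(n < N) c n * iter n A x k.

(** The limit is taken coordinate by coordinate, which is why [A_lim] asks for coordinatewise
    continuity. *)
Definition op_series c x k : R := limn (fun N => op_sum c N x k).

Lemma op_sumE c N x k : op_sum c N x k = \sum_(0 <= n < N) c n * iter n A x k.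
Proof. by rewrite big_mkord. Qed.

Lemma iter_bounded n x r : bounded_by w x r ->
  bounded_by w (iter n A x) (M ^+ n * r).
Proof.
move=> xr; elim: n => [|n ih] /=; first by rewrite expr0 mul1r.
by rewrite exprS -mulrA; exact: A_bounded.
Qed.

Lemma op_zero : A (fun=> 0) = fun=> 0.
Proof.
have := A_linear (fun=> 0) (-1) (fun=> 0).
under eq_fun do rewrite mulr0 addr0.
move=> h; rewrite {}h; apply/funext => k.
by rewrite mulN1r subrr.
Qed.

Lemma op_op_sum c N x k :
  A (op_sum c N x) k = \sum_(n < N) c n * iter n.+1 A x k.
Proof.
suff -> : A (op_sum c N x) = fun k => \sum_(n < N) c n * iter n.+1 A x k by [].
elim: N => [|N ih].
  rewrite [op_sum c 0 x](_ : _ = fun=> 0).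
    by rewrite op_zero; apply/funext => j; rewrite big_ord0.
  by apply/funext => j; rewrite /op_sum big_ord0.
rewrite [op_sum c N.+1 x](_ : _ = fun k => op_sum c N x k + c N * iter N A x k).
  by rewrite A_linear ih; apply/funext => j; rewrite big_ord_recr.
by apply/funext => j; rewrite /op_sum big_ord_recr.
Qed.

Lemma op_sum_sub_bounded c x r N N' : bounded_by w x r -> (N <= N')%N ->
  bounded_by w (fun k => op_sum c N' x k - op_sum c N x k)
    ((\sum_(N <= n < N') `|c n| * M ^+ n) * r).
Proof.
move=> xr NN'.
rewrite (_ : (fun k => _) = fun k => \sum_(N <= n < N') c n * iter n A x k).
  rewrite mulr_suml; apply: bounded_by_sum => // n.
  by rewrite -mulrA; apply: bounded_by_scale; exact: iter_bounded.
apply/funext => k; rewrite !op_sumE (big_cat_nat (m := 0) (n := N) (p := N')) //=; ring.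
Qed.

Lemma op_sum_bounded c x r N : bounded_by w x r ->
  bounded_by w (op_sum c N x) ((\sum_(0 <= n < N) `|c n| * M ^+ n) * r).
Proof.
move=> xr; have := op_sum_sub_bounded c xr (leq0n N).
by under eq_fun do rewrite /op_sum big_ord0 subr0.
Qed.

(** Each coordinate converges absolutely: its n-th term is at most |c n| M^n times the bound on that
    coordinate of a sequence of norm [r]. *)
Lemma op_series_cvg c x r B : (forall N, \sum_(0 <= n < N) `|c n| * M ^+ n <= B) ->
  bounded_by w x r ->
  forall k, op_sum c N x k @[N --> \oo] --> op_series c x k.
Proof.
(* [bounded_by_coord] says nothing at index 0, but there every partial sum vanishes. *)
move=> cB xr [|k].
  have z : (fun N => op_sum c N x 0%N) = fun=> 0.
    by apply/funext => N; have [] := op_sum_bounded c N xr.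
  by rewrite /op_series z lim_cst //; exact: cvg_cst.
suff : cvgn (series (fun n => c n * iter n A x k.+1)).
  rewrite /op_series; suff -> : series (fun n => c n * iter n A x k.+1) =
    fun N => op_sum c N x k.+1 by [].
  by apply/funext => N; rewrite op_sumE.
apply: normed_cvg; apply: nondecreasing_is_cvgn.
  by apply: nondecreasing_series => n _ _; exact: normr_ge0.
exists (B * (r / Num.sqrt (w k.+1))) => _ [N _ <-].
apply: (@le_trans _ _ ((\sum_(0 <= n < N) `|c n| * M ^+ n) * (r / Num.sqrt (w k.+1)))).
  rewrite /series /= mulr_suml; apply: ler_sum => n _; rewrite normrM -mulrA.
  rewrite ler_wpM2l // mulrA.
  by apply: bounded_by_coord => //; exact: iter_bounded.
by rewrite ler_wpM2r // divr_ge0 ?sqrtr_ge0 //; case: xr.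
Qed.

Lemma op_series_bounded c x r B : (forall N, \sum_(0 <= n < N) `|c n| * M ^+ n <= B) ->
  bounded_by w x r -> bounded_by w (op_series c x) (B * r).
Proof.
move=> cB xr.
apply: (@bounded_by_lim _ _ _ \oo _ (fun N => op_sum c N x) (fun=> B * r)).
- exact: op_series_cvg cB xr.
- exact: cvg_cst.
- apply: nearW => N; apply: (bounded_by_le _ (op_sum_bounded c N xr)).
  by rewrite ler_wpM2r //; case: xr.
Qed.

Definition op_exp t x : nat -> R := op_series (exp_coeff t) x.

Lemma norm_exp_coeff t n : 0 <= t ->
  `|exp_coeff t n| * M ^+ n = exp_coeff (t * M) n.
Proof.
move=> t0; rewrite /exp_coeff /= ger0_norm ?divr_ge0 ?exprn_ge0 //.
by rewrite exprMn mulrAC.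
Qed.

Lemma series_exp_coeff_cvg t : series (exp_coeff t) N @[N --> \oo] --> expR t.
Proof. exact: is_cvg_series_exp_coeff. Qed.

Lemma exp_coeff_sum_le t N : 0 <= t ->
  \sum_(0 <= n < N) `|exp_coeff t n| * M ^+ n <= expR (t * M).
Proof.
move=> t0; under eq_bigr do rewrite norm_exp_coeff //.
apply: (nondecreasing_cvgn_le _ (@is_cvg_series_exp_coeff R (t * M))).
apply: nondecreasing_series => n _ _.
by rewrite /exp_coeff /= divr_ge0 ?exprn_ge0 ?mulr_ge0.
Qed.

Lemma op_exp_cvg t x r : 0 <= t -> bounded_by w x r ->
  forall k, op_sum (exp_coeff t) N x k @[N --> \oo] --> op_exp t x k.
Proof.
by move=> t0; apply: op_series_cvg => N; exact: exp_coeff_sum_le.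
Qed.

Lemma op_exp_bounded t x r : 0 <= t -> bounded_by w x r ->
  bounded_by w (op_exp t x) (expR (t * M) * r).
Proof.
by move=> t0; apply: op_series_bounded => N; exact: exp_coeff_sum_le.
Qed.

Lemma op_exp0 x r : bounded_by w x r -> op_exp 0 x = x.
Proof.
move=> xr; apply/funext => k.
apply: (cvg_unique _ (op_exp_cvg (lexx 0) xr (k := k))) => //.
apply: (@cvg_trans _ (x k @[N --> \oo])); last exact: cvg_cst.
apply: near_eq_cvg; near=> N.
have N0 : (0 < N)%N by near: N; exact: nbhs_infty_gt.
rewrite /op_sum -(prednK N0) big_ord_recl big1 => [|i _].
  by rewrite /exp_coeff /= expr0 fact0 divr1 mul1r addr0.
by rewrite /exp_coeff /= expr0n /= mul0r mul0r.
Unshelve. all: by end_near. Qed.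

Lemma op_exp_tail_bounded t x r N : 0 <= t -> bounded_by w x r ->
  bounded_by w (fun k => op_sum (exp_coeff t) N x k - op_exp t x k)
    ((expR (t * M) - series (exp_coeff (t * M)) N) * r).
Proof.
move=> t0 xr.
apply: (@bounded_by_lim _ _ _ \oo _
  (fun N' k => op_sum (exp_coeff t) N x k - op_sum (exp_coeff t) N' x k)
  (fun N' => (series (exp_coeff (t * M)) N' - series (exp_coeff (t * M)) N) * r)).
- by move=> k; apply: cvgB; [exact: cvg_cst|exact: op_exp_cvg xr _].
- apply: cvgMr_tmp; apply: cvgB; last exact: cvg_cst.
  exact: series_exp_coeff_cvg.
near=> N'; have NN' : (N <= N')%N by near: N'; exact: nbhs_infty_ge.
have := bounded_by_scale (-1) (op_sum_sub_bounded (exp_coeff t) xr NN').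
rewrite normrN1 mul1r.
congr bounded_by; first by apply/funext => k /=; ring.
congr (_ * r); under eq_bigr do rewrite norm_exp_coeff //.
by rewrite /series /= (big_cat_nat (m := 0) (n := N) (p := N')) //=; ring.
Unshelve. all: by end_near. Qed.

(** Coefficient of A^n in (e^{sA} - e^{tA}) / (s - t) - A e^{tA}; the extra factor A shifts the
    index of the last term by one. *)
Definition exp_coeff_diff t s n : R :=
  (exp_coeff s n - exp_coeff t n) / (s - t)
    - (if n is m.+1 then exp_coeff t m else 0).

(* [(s^n - t^n) / (s - t) - n t^(n-1)] has the sign of [s - t], so its
   absolute series sums to that of the exponential. *)
Lemma exp_coeff_diff_sign t s n : 0 <= t -> 0 <= s -> s != t ->
  0 <= Num.sg (s - t) * exp_coeff_diff t s n.
Proof.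
move=> t0 s0 st; have st0 : s - t != 0 by rewrite subr_eq0.
rewrite /exp_coeff_diff; case: n => [|m].
  by rewrite /exp_coeff /= !expr0 subrr mul0r subr0 mulr0.
have f0 : (m.+1)`!%:R != 0 :> R by rewrite pnatr_eq0 -lt0n fact_gt0.
have -> : (exp_coeff s m.+1 - exp_coeff t m.+1) / (s - t) - exp_coeff t m =
    (\sum_(i < m.+1) (s ^+ (m - i) - t ^+ (m - i)) * t ^+ i) / (m.+1)`!%:R.
  rewrite /exp_coeff /= -mulrBl subrXX /= -mulrA mulrAC -mulrA [_^-1 * _]mulrC.
  rewrite !mulrA.
  have -> : t ^+ m / m`!%:R = (\sum_(i < m.+1) t ^+ (m - i) * t ^+ i) / (m.+1)`!%:R.
    rewrite (eq_bigr (fun=> t ^+ m)) => [|i _]; last first.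
      by rewrite -exprD subnK // -ltnS ltn_ord.
    rewrite sumr_const card_ord factS natrM -[t ^+ m *+ _]mulr_natr.
    by rewrite invfM mulrA mulfK // pnatr_eq0.
  rewrite mulrAC divff // mul1r -mulrBl -sumrB; congr (_ / _).
  by apply: eq_bigr => i _; rewrite mulrBl.
rewrite mulrA; apply: divr_ge0 => //.
rewrite mulr_sumr; apply: sumr_ge0 => i _.
rewrite mulrA mulr_ge0 ?exprn_ge0 //.
have [ts|ts|/eqP] := ltgtP t s; last by rewrite eq_sym (negbTE st).
  by rewrite gtr0_sg ?subr_gt0 // mul1r subr_ge0 lerXn2r ?nnegrE // ltW.
by rewrite ltr0_sg ?subr_lt0 // mulN1r opprB subr_ge0 lerXn2r ?nnegrE // ltW.
Qed.

Definition exp_diff t s : R :=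
  (expR (s * M) - expR (t * M)) / (s - t) - M * expR (t * M).

Lemma exp_coeff_diff_cvg t s :
  \sum_(0 <= n < N) exp_coeff_diff t s n * M ^+ n @[N --> \oo] --> exp_diff t s.
Proof.
(* With N.+1 terms of the difference quotient go only N terms of the derivative, whose coefficients
   are shifted by one. *)
rewrite -(cvg_shiftS (fun N => \sum_(0 <= n < N) _)) /=.
rewrite (_ : (fun N => _) = (fun N =>
   (series (exp_coeff (s * M)) N.+1 - series (exp_coeff (t * M)) N.+1) / (s - t)
   - M * series (exp_coeff (t * M)) N)).
  apply: cvgB.
    apply: cvgMr_tmp; apply: cvgB; rewrite (cvg_shiftS (series _)).
      exact: series_exp_coeff_cvg.
    exact: series_exp_coeff_cvg.
  by apply: cvgMl_tmp; exact: series_exp_coeff_cvg.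
apply/funext => N; rewrite /series /= -sumrB mulr_suml mulr_sumr.
rewrite !big_nat_recl //= /exp_coeff_diff.
under eq_bigr do rewrite mulrBl.
rewrite sumrB addrA subr0; congr (_ - _); last first.
  by apply: eq_bigr => n _; rewrite /exp_coeff /= exprS exprMn; ring.
congr (_ + _); last apply: eq_bigr => n _;
  by rewrite /exp_coeff /= !exprMn; ring.
Qed.

Lemma exp_diff_cvg0 t : exp_diff t s @[s --> t^'] --> 0.
Proof.
have d : is_derive t 1 (fun s => expR (s * M)) (M * expR (t * M)).
  by apply: is_derive_eq; rewrite /GRing.scale /=; ring.
have cd : h^-1 *: (expR ((h *: 1 + t) * M) - expR (t * M)) @[h --> (0 : R)^']
    --> M * expR (t * M).
  by rewrite -(@derive_val _ _ _ _ _ _ _ d); exact: (@ex_derive _ _ _ _ _ _ _ d).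
(* Substituting h = s - t keeps h away from 0, since translation is injective. *)
have sub_cvg : s - t @[s --> t^'] --> (0 : R)^'.
  rewrite -(subrr t); apply: continuous_injective_withinNx.
    by apply: cvgB; [exact: cvg_id|exact: cvg_cst].
  by move=> s /addIr.
rewrite -(subrr (M * expR (t * M))); apply: cvgB; last exact: cvg_cst.
have := cvg_comp _ _ sub_cvg cd.
apply: cvg_trans; apply: near_eq_cvg; apply: nearW => s /=.
by rewrite /GRing.scale /= mulr1 subrK mulrC.
Qed.

(** By constancy of sign, the absolute series is sg (s - t) times the signed one, so its partial
    sums increase to sg (s - t) times [exp_diff t s]. *)
Lemma exp_coeff_diff_le t s N : 0 <= t -> 0 <= s -> s != t ->
  \sum_(0 <= n < N) `|exp_coeff_diff t s n| * M ^+ n <= `|exp_diff t s|.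
Proof.
move=> t0 s0 st; have st0 : s - t != 0 by rewrite subr_eq0.
have -> : \sum_(0 <= n < N) `|exp_coeff_diff t s n| * M ^+ n =
    series (fun n => Num.sg (s - t) * (exp_coeff_diff t s n * M ^+ n)) N.
  apply: eq_bigr => n _; rewrite mulrA; congr (_ * _).
  rewrite -[RHS]ger0_norm ?exp_coeff_diff_sign //.
  by rewrite normrM normr_sg st0 mul1r.
have c : series (fun n => Num.sg (s - t) * (exp_coeff_diff t s n * M ^+ n)) N'
    @[N' --> \oo] --> Num.sg (s - t) * exp_diff t s.
  rewrite (_ : series _ = fun N' =>
      Num.sg (s - t) * \sum_(0 <= n < N') (exp_coeff_diff t s n * M ^+ n)).
    by apply: cvgMl_tmp; exact: exp_coeff_diff_cvg.
  by apply/funext => N'; rewrite /series /= mulr_sumr.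
apply: (@le_trans _ _ (Num.sg (s - t) * exp_diff t s)).
  rewrite -(cvg_lim _ c) //; apply: nondecreasing_cvgn_le; last first.
    by apply/cvg_ex; eexists; exact: c.
  apply: nondecreasing_series => n _ _; rewrite mulrA mulr_ge0 ?exprn_ge0 //.
  exact: exp_coeff_diff_sign.
by apply: le_trans (ler_norm _) _; rewrite normrM normr_sg st0 mul1r.
Qed.

(** The error is itself an operator series, with coefficients [exp_coeff_diff]: both sides are
    coordinatewise limits of the same partial sums, [A_lim] carrying A through the limit. *)
Lemma op_exp_diff_bounded t s x r : 0 <= t -> 0 <= s -> s != t ->
  bounded_by w x r ->
  bounded_by w
    (fun k => (op_exp s x k - op_exp t x k) / (s - t) - A (op_exp t x) k)
    (`|exp_diff t s| * r).
Proof.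
move=> t0 s0 st xr.
have dB N := exp_coeff_diff_le N t0 s0 st.
suff -> : (fun k => (op_exp s x k - op_exp t x k) / (s - t) - A (op_exp t x) k) =
    op_series (exp_coeff_diff t s) x by exact: op_series_bounded dB xr.
apply/funext => k; apply/esym.
have := op_series_cvg dB xr (k := k).
rewrite -(cvg_shiftS (fun N => op_sum _ N x k)) /= => h.
apply: (cvg_unique _ h) => //.
rewrite (_ : (fun N => _) = (fun N =>
   (op_sum (exp_coeff s) N.+1 x k - op_sum (exp_coeff t) N.+1 x k) / (s - t)
   - A (op_sum (exp_coeff t) N x) k)).
  apply: cvgB.
    apply: cvgMr_tmp; apply: cvgB; rewrite (cvg_shiftS (fun N => op_sum _ N x k)).
      exact: op_exp_cvg xr _.
    exact: op_exp_cvg xr _.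
  by apply: A_lim => j; exact: op_exp_cvg xr _.
apply/funext => N; rewrite op_op_sum /op_sum -sumrB mulr_suml !big_ord_recl.
rewrite /exp_coeff_diff /=; under eq_bigr do rewrite mulrBl.
rewrite sumrB addrA subr0; congr (_ - _).
congr (_ + _); first by rewrite mulrAC [in LHS]mulrBl.
by apply: eq_bigr => n _; rewrite mulrAC [in LHS]mulrBl.
Qed.

End OperatorSeries.

(** * Exponential decay of solutions from contracting Euler steps *)

Section Decay.
Variables (R : realType) (w : nat -> R).
Hypothesis w_gt0 : forall k, (0 < k)%N -> 0 < w k.
Variables (A : (nat -> R) -> nat -> R) (M : R).
Hypothesis A_bounded : forall x r,
  bounded_by w x r -> bounded_by w (A x) (M * r).
Variables (g h0 : R).
Hypothesis g_gt0 : 0 < g.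
Hypothesis h0_gt0 : 0 < h0.
Hypothesis euler_step : forall (h : R) x q, 0 <= h <= h0 -> bounded_by w x q ->
  bounded_by w (fun k => x k + h * A x k) ((1 - 2 * g * h) * q).
Variable y : R -> nat -> R.
Hypothesis y_bounded : forall t : R, 0 <= t -> exists r, bounded_by w (y t) r.
Hypothesis y_derive : forall t e : R, 0 <= t -> 0 < e ->
  exists2 d, 0 < d & forall s : R, 0 <= s -> s != t -> `|s - t| < d ->
    bounded_by w (fun k => (y s k - y t k) / (s - t) - A (y t) k) e.

(** The exact value y (t + h) is the Euler step plus h times the error of the difference quotient.
    Half of the contraction 2 g h absorbs an error of size g q, and 1 - g h <= exp (- g h). *)
Lemma decay_right (t q : R) : 0 <= t -> 0 < q -> bounded_by w (y t) q ->
  exists2 d, 0 < d & forall h, 0 <= h < d ->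
    bounded_by w (y (t + h)) (expR (- (g * h)) * q).
Proof.
move=> t0 q0 yq; have gq0 : 0 < g * q by exact: mulr_gt0.
have [d d0 dP] := y_derive t0 gq0.
exists (Num.min d h0); first by rewrite lt_min d0 h0_gt0.
move=> h; rewrite lt_min => /and3P[h_ge0 hd hh0].
have [->|hn0] := eqVneq h 0; first by rewrite mulr0 oppr0 expR0 mul1r addr0.
have hgt0 : 0 < h by rewrite lt_neqAle eq_sym hn0.
have := dP (t + h); rewrite [t + h - t]addrC addKr ger0_norm // => /(_ _ _ hd).
rewrite -subr_eq0 [t + h - t]addrC addKr addr_ge0 // => /(_ isT hn0) eq.
have hh : 0 <= h <= h0 by rewrite h_ge0 ltW.
have := bounded_by_add w_gt0 (euler_step hh yq) (bounded_by_scale h eq).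
rewrite (_ : (fun k => _) = y (t + h)); last first.
  by apply/funext => k; field.
apply: bounded_by_le; rewrite ger0_norm //.
have -> : (1 - 2 * g * h) * q + h * (g * q) = (1 + - (g * h)) * q by ring.
by rewrite ler_wpM2r ?(ltW q0) // expR_ge1Dx.
Qed.

(** Left continuity: y t differs from y s by (t - s) times a difference quotient, whose norm near t
    is at most 1 + M q, with 1 for its error and M q for A (y t). *)
Lemma decay_left (t r : R) : 0 < t ->
  (forall s, 0 <= s < t -> bounded_by w (y s) (expR (- (g * s)) * r)) ->
  bounded_by w (y t) (expR (- (g * t)) * r).
Proof.
move=> t0 yr.
have [q yq] := y_bounded (ltW t0).
have [d d0 dP] := y_derive (ltW t0) ltr01.
apply: (@bounded_by_cst_lim _ _ _ (at_left t) _
  (fun s => expR (- (g * s)) * r + `|s - t| * (1 + M * q))).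
  apply: cvg_at_left_filter.
  rewrite -[X in _ --> X]addr0 -(mul0r (1 + M * q)).
  apply: cvgD; apply: cvgMr_tmp.
    apply: (cvg_comp (fun s => - (g * s)) expR); last exact: continuous_expR.
    by apply: cvgN; apply: cvgMl_tmp; exact: cvg_id.
  have : s - t @[s --> t] --> t - t by apply: cvgB; [exact: cvg_id|exact: cvg_cst].
  by rewrite subrr => /cvg_norm; rewrite normr0.
near=> s.
have st : s < t by near: s; exact: nbhs_left_lt.
have s0 : 0 <= s by near: s; exact: nbhs_left_ge.
have sd : `|s - t| < d.
  rewrite ltr0_norm ?subr_lt0 // opprB ltrBlDl -ltrBlDr.
  by near: s; apply: nbhs_left_gt; rewrite ltrBlDr ltrDl.
have := dP s s0 (negbT (lt_eqF st)) sd => eq.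
have := bounded_by_add w_gt0 eq (A_bounded yq).
move=> /(bounded_by_scale (- (s - t))); rewrite normrN.
have ys : bounded_by w (y s) (expR (- (g * s)) * r) by apply: yr; rewrite s0.
move=> /(bounded_by_add w_gt0 ys).
rewrite (_ : (fun k => _) = y t) //.
by apply/funext => k; field; rewrite subr_eq0 lt_eqF.
Unshelve. all: by end_near. Qed.

(* Real induction on the largest interval on which the bound holds *)
Lemma decay_pos (r t : R) : 0 < r -> bounded_by w (y 0) r -> 0 <= t ->
  bounded_by w (y t) (expR (- (g * t)) * r).
Proof.
move=> r0 yr t0; set P := fun t => bounded_by w (y t) (expR (- (g * t)) * r).
apply: contrapT => nPt.
pose S := [set u : R | 0 <= u /\ forall s : R, 0 <= s <= u -> P s].
have S0 : S 0.
  split=> // s; rewrite -eq_le => /eqP <-.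
  by rewrite /P mulr0 oppr0 expR0 mul1r.
have supS : has_sup S.
  split; first by exists 0.
  exists t => u [u0 uP]; rewrite leNgt; apply/negP => tu.
  by apply: nPt; apply: uP; rewrite t0 ltW.
have tau0 : 0 <= sup S by apply: ub_le_sup => //; case: supS.
have belowP s : 0 <= s < sup S -> P s.
  move=> /andP[s0 stau]; have : 0 < sup S - s by rewrite subr_gt0.
  move=> /sup_adherent /(_ supS)[u [_ uP]]; rewrite subKr => su.
  by apply: uP; rewrite s0 ltW.
have Ptau : P (sup S).
  have [tau_gt0|] := ltP 0 (sup S).
    exact: decay_left.
  move=> tau_le0; have -> : sup S = 0 by apply/eqP; rewrite eq_le tau_le0.
  by rewrite /P mulr0 oppr0 expR0 mul1r.
have q0 : 0 < expR (- (g * sup S)) * r by rewrite mulr_gt0 ?expR_gt0.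
have [d d0 dP] := decay_right tau0 q0 Ptau.
(* Decay to the right of sup S composes with the bound at sup S, by the product of exponentials. The
   half leaves a closed interval inside the range of [dP], against the choice of sup S. *)
have : S (sup S + d / 2).
  have d20 : 0 < d / 2 by rewrite divr_gt0.
  split; first by rewrite addr_ge0 ?(ltW d20).
  move=> s /andP[s0 sd]; have [stau|taus] := ltP s (sup S).
    by apply: belowP; rewrite s0.
  have := dP (s - sup S).
  have -> : sup S + (s - sup S) = s by ring.
  rewrite mulrA -expRD -opprD -mulrDr subrK; apply.
  by rewrite subr_ge0 taus /=; lra.
move=> /(ub_le_sup (proj2 supS)); lra.
Qed.

(** [decay_pos] asks for a positive radius, as the error tolerance g q must be positive. Letting q
    decrease to r covers r = 0, on which uniqueness rests. *)
Lemma solution_decay (r t : R) : bounded_by w (y 0) r -> 0 <= t ->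
  bounded_by w (y t) (expR (- (g * t)) * r).
Proof.
move=> yr t0; have [_ r0 _] := yr.
apply: (@bounded_by_cst_lim _ _ _ (at_right r) _ (fun q => expR (- (g * t)) * q)).
  by apply: cvg_at_right_filter; apply: cvgMl_tmp; exact: cvg_id.
near=> q; have rq : r < q by near: q; exact: nbhs_right_gt.
apply: decay_pos => //; first exact: le_lt_trans rq.
by apply: bounded_by_le yr; exact: ltW.
Unshelve. all: by end_near. Qed.

End Decay.

(** * Birth-death operators and their boundedness *)

Definition birth_death (R : realType) (a : nat -> R) (beta : R) (x : nat -> R)
    (k : nat) : R :=
  if k is j.+1 then a j * x j - (a k + beta) * x k + beta * x k.+1 else 0.

Section BirthDeath.
Variables (R : realType) (a : nat -> R) (beta : R).
Implicit Types (x : nat -> R) (r : R).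
Let K := birth_death a beta.

Lemma birth_death_linear x c y :
  K (fun k => x k + c * y k) = fun k => K x k + c * K y k.
Proof. by apply/funext => -[|k]; rewrite /K /=; ring. Qed.

Lemma birth_death_lim (u : nat -> nat -> R) l :
  (forall k, u n k @[n --> \oo] --> l k) ->
  forall k, K (u n) k @[n --> \oo] --> K l k.
Proof.
move=> ul [|k]; first exact: cvg_cst.
by apply: cvgD; [apply: cvgB|]; apply: cvgMl_tmp; exact: ul.
Qed.

Section Bounded.
Variable w : nat -> R.
Hypothesis w_gt0 : forall k, (0 < k)%N -> 0 < w k.

Lemma shift_right_bounded c x r : 0 <= c ->
  (forall k, (0 < k)%N -> w k.+1 <= c ^+ 2 * w k) -> bounded_by w x r ->
  bounded_by w (fun k => if k is j.+1 then x j else 0) (c * r).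
Proof.
move=> c0 wc [x0 r0 xr]; split => //; first exact: mulr_ge0.
case=> [|[|N]]; [by rewrite big_geq ?sqr_ge0|by rewrite big_geq ?sqr_ge0|].
(* The entry shifted into place 1 is [x 0 = 0], so ratios of weights enter only from index 1 on. *)
rewrite big_add1 big_nat_recl //= x0 expr0n mul0r add0r.
apply: (@le_trans _ _ (c ^+ 2 * \sum_(1 <= k < N.+1) x k ^+ 2 * w k)).
  rewrite mulr_sumr big_add1; apply: ler_sum => k _.
  by rewrite mulrCA ler_wpM2l ?sqr_ge0 ?wc.
by rewrite exprMn ler_wpM2l ?sqr_ge0.
Qed.

Lemma shift_left_bounded x r :
  (forall k, (0 < k)%N -> w k <= w k.+1) -> bounded_by w x r ->
  bounded_by w (fun k => if k is j.+1 then x k.+1 else 0) r.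
Proof.
move=> wc [x0 r0 xr]; split => // -[|N]; first by rewrite big_geq ?sqr_ge0.
apply: le_trans (xr N.+2).
rewrite (big_nat_recl N.+1) //= big_add1 /=.
rewrite -[leLHS]add0r; apply: lerD.
  by rewrite mulr_ge0 ?sqr_ge0 // ltW // w_gt0.
rewrite [leRHS]big_add1; apply: ler_sum => k _.
by rewrite ler_wpM2l ?sqr_ge0 ?wc.
Qed.

Lemma mul_bounded c (d : nat -> R) x r : 0 <= c -> (forall k, `|d k| <= c) ->
  bounded_by w x r -> bounded_by w (fun k => d k * x k) (c * r).
Proof.
move=> c0 dc [x0 r0 xr]; split; [by rewrite x0 mulr0|exact: mulr_ge0|move=> N].
rewrite exprMn; apply: le_trans (ler_wpM2l (sqr_ge0 c) (xr N)).
rewrite mulr_sumr !big_seq; apply: ler_sum => k.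
rewrite mem_index_iota => /andP[k0 _]; rewrite exprMn -mulrA.
apply: ler_wpM2r; first by rewrite mulr_ge0 ?sqr_ge0 // ltW // w_gt0.
by rewrite -[d k ^+ 2]real_normK ?num_real // ler_sqr ?nnegrE.
Qed.

(** The three summands of the constant come from the birth, diagonal and death terms. *)
Lemma birth_death_bounded a1 c x r : 0 <= beta -> 0 <= c ->
  (forall k, 0 <= a k <= a1) ->
  (forall k, (0 < k)%N -> w k.+1 <= c ^+ 2 * w k) ->
  (forall k, (0 < k)%N -> w k <= w k.+1) ->
  bounded_by w x r -> bounded_by w (K x) ((c * a1 + (a1 + beta) + beta) * r).
Proof.
move=> b0 c0 aa wc wi xr.
have a10 : 0 <= a1 by case/andP: (aa 0%N); exact: le_trans.
have h1 : bounded_by w (fun k => a k * x k) (a1 * r).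
  by apply: mul_bounded => // k; case/andP: (aa k) => ? ?; rewrite ger0_norm.
have h2 : bounded_by w (fun k => (a k + beta) * x k) ((a1 + beta) * r).
  apply: mul_bounded => // [|k]; first exact: addr_ge0.
  by case/andP: (aa k) => ? ?; rewrite ger0_norm ?addr_ge0 // lerD2r.
have h3 := bounded_by_scale beta (shift_left_bounded wi xr).
have := bounded_by_add w_gt0 (bounded_by_sub w_gt0
  (shift_right_bounded c0 wc h1) h2) h3.
rewrite (ger0_norm b0) mulrA -!mulrDl; congr bounded_by.
apply/funext => -[|k] //=; have [-> _ _] := xr; ring.
Qed.

End Bounded.

(** * The Schur test and the contraction of Euler steps *)

Section Schur.
Variables (phi psi : nat -> R) (gam : R).
Hypothesis beta_ge0 : 0 <= beta.
Hypothesis a_ge0 : forall k, 0 <= a k.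
Hypothesis phi_gt0 : forall k, (0 < k)%N -> 0 < phi k.
Hypothesis phi0_ge0 : 0 <= phi 0%N.
Hypothesis psi_gt0 : forall k, (0 < k)%N -> 0 < psi k.
Hypothesis psi0_ge0 : 0 <= psi 0%N.
Hypothesis phi_super : forall k,
  a k * phi k + beta * phi k.+2 <= (a k.+1 + beta - gam) * phi k.+1.
Hypothesis psi_super : forall k,
  a k.+1 * psi k.+2 + beta * psi k <= (a k.+1 + beta - gam) * psi k.+1.
Let w k := psi k / phi k.

Lemma schur_weight_gt0 k : (0 < k)%N -> 0 < w k.
Proof. by move=> k0; rewrite divr_gt0 ?phi_gt0 ?psi_gt0. Qed.

(** The right-hand side is the boundary term of a truncated Schur test. With x = phi u, its
    increment exceeds the new summand by half of a sum of nonnegative terms: multiples of squares of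
    differences of neighbouring u, and of the defects in [phi_super] and [psi_super]. *)
Lemma schur_partial_sum x N : x 0%N = 0 ->
  \sum_(1 <= k < N.+1) (x k * K x k + gam * x k ^+ 2) * w k <=
  (beta * psi N * phi N.+1 * (x N.+1 / phi N.+1) ^+ 2
   - a N * psi N.+1 * phi N * (x N / phi N) ^+ 2) / 2.
Proof.
move=> x0.
have phi_ge0 k : 0 <= phi k by case: k => // k; rewrite ltW ?phi_gt0.
have psi_ge0 k : 0 <= psi k by case: k => // k; rewrite ltW ?psi_gt0.
pose u k := x k / phi k.
have xu k : x k = phi k * u k.
  case: k => [|k]; first by rewrite /u x0 mul0r mulr0.
  by rewrite /u mulrC divfK // gt_eqF ?phi_gt0.
elim: N => [|N ih].
  rewrite big_geq // x0 mul0r expr0n mulr0 subr0 divr_ge0 //.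
  by rewrite mulr_ge0 ?sqr_ge0 ?mulr_ge0.
rewrite big_nat_recr //=; apply: (le_trans (lerD ih (lexx _))).
rewrite -/(u N) -/(u N.+1) -/(u N.+2) /w.
rewrite (xu N) (xu N.+1) (xu N.+2) -subr_ge0.
have p0 : phi N.+1 != 0 by rewrite gt_eqF ?phi_gt0.
set c := a N.+1 + beta - gam.
rewrite (_ : _ - _ = (psi N.+1 * (a N * phi N) * (u N - u N.+1) ^+ 2
    + psi N.+1 * (beta * phi N.+2) * (u N.+1 - u N.+2) ^+ 2
    + u N.+1 ^+ 2 *
       (psi N.+1 * (c * phi N.+1 - (a N * phi N + beta * phi N.+2))
        + phi N.+1 * (c * psi N.+1 - (a N.+1 * psi N.+2 + beta * psi N)))) / 2);
  last by rewrite /c; field.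
apply: divr_ge0 => //; apply: addr_ge0; first apply: addr_ge0.
- by rewrite mulr_ge0 ?sqr_ge0 ?mulr_ge0.
- by rewrite mulr_ge0 ?sqr_ge0 ?mulr_ge0.
- rewrite mulr_ge0 ?sqr_ge0 // addr_ge0 // mulr_ge0 // subr_ge0.
    exact: phi_super.
  exact: psi_super.
Qed.

Variable M : R.
Hypothesis gam_gt0 : 0 < gam.
Hypothesis K_bounded : forall x r,
  bounded_by w x r -> bounded_by w (K x) (M * r).

(* For finitely supported [x] the boundary term of [schur_partial_sum] is 0. *)
Lemma euler_step_finite h x r n :
  (forall k, (n <= k)%N -> x k = 0) ->
  0 <= h -> 2 * gam * h <= 1 -> h * M ^+ 2 <= gam -> bounded_by w x r ->
  bounded_by w (fun k => x k + h * K x k) ((1 - gam / 2 * h) * r).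
Proof.
move=> xn h0 hg hM xr; have [x0 r0 xN] := xr; have [_ _ KN] := K_bounded xr.
have c0 : 0 <= 1 - gam / 2 * h by have := mulr_ge0 (ltW gam_gt0) h0; lra.
split; [by rewrite x0 mulr0 addr0|exact: mulr_ge0|move=> N].
(* Past both N and the support: enlarging the sum adds nonnegative terms, and the boundary term at m
   vanishes. *)
pose m := maxn N n.+1.
have Nm : (N <= m.+1)%N by rewrite leqW // leq_maxl.
apply: (@le_trans _ _ (\sum_(1 <= k < m.+1) (x k + h * K x k) ^+ 2 * w k)).
  case: (leqP N 1) => N1.
    rewrite (big_geq N1) big_seq; apply: sumr_ge0 => k.
    rewrite mem_index_iota => /andP[k0 _].
    by rewrite mulr_ge0 ?sqr_ge0 // ltW // schur_weight_gt0.
  rewrite (big_cat_nat (n := N) (p := m.+1)) ?(ltnW N1) //= lerDl.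
  rewrite big_seq; apply: sumr_ge0 => k; rewrite mem_index_iota => /andP[Nk _].
  by rewrite mulr_ge0 ?sqr_ge0 // ltW // schur_weight_gt0 // (leq_trans _ Nk) // ltnW.
(* The square is expanded and 2 gam h x^2 subtracted and added, to bring out the nonpositive Schur
   sum. *)
have -> : \sum_(1 <= k < m.+1) (x k + h * K x k) ^+ 2 * w k =
  (1 - 2 * gam * h) * (\sum_(1 <= k < m.+1) x k ^+ 2 * w k)
  + 2 * h * (\sum_(1 <= k < m.+1) (x k * K x k + gam * x k ^+ 2) * w k)
  + h ^+ 2 * (\sum_(1 <= k < m.+1) K x k ^+ 2 * w k).
  by rewrite !mulr_sumr -!big_split /=; apply: eq_bigr => k _; ring.
have mn : (n <= m)%N by rewrite (leq_trans (leqnSn n)) // leq_maxr.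
have S0 : \sum_(1 <= k < m.+1) (x k * K x k + gam * x k ^+ 2) * w k <= 0.
  apply: le_trans (schur_partial_sum m x0) _.
  by rewrite !xn // ?(leqW mn) // !mul0r expr0n /= !mulr0 subrr mul0r.
apply: (@le_trans _ _ ((1 - 2 * gam * h) * r ^+ 2 + 0 + h ^+ 2 * (M * r) ^+ 2)).
  apply: lerD; first apply: lerD.
  - by rewrite ler_wpM2l // subr_ge0.
  - by rewrite mulr_ge0_le0 // mulr_ge0.
  - by rewrite ler_wpM2l ?sqr_ge0.
rewrite addr0 !exprMn [h ^+ 2 * _]mulrA -mulrDl ler_wpM2r ?sqr_ge0 //.
(* Now 1 - 2 gam h + h^2 M^2 <= 1 - gam h <= (1 - gam h / 2)^2. *)
have : h * (h * M ^+ 2) <= h * gam by rewrite ler_wpM2l.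
have := sqr_ge0 (gam * h).
rewrite !expr2; lra.
Qed.

(** Truncations of x have norm at most [r] and converge to x coordinatewise, and each coordinate of
    K x involves finitely many coordinates of x. *)
Lemma euler_step h x r :
  0 <= h -> 2 * gam * h <= 1 -> h * M ^+ 2 <= gam -> bounded_by w x r ->
  bounded_by w (fun k => x k + h * K x k) ((1 - gam / 2 * h) * r).
Proof.
move=> h0 hg hM xr; have [x0 r0 xN] := xr.
pose tr n k := if (k < n)%N then x k else 0.
have trx k : tr n k @[n --> \oo] --> x k.
  apply: (@cvg_trans _ (x k @[n --> \oo])); last exact: cvg_cst.
  apply: near_eq_cvg; near=> n; rewrite /tr ifT //.
  by near: n; exact: nbhs_infty_gt.
apply: (@bounded_by_lim _ _ _ \oo _ (fun n k => tr n k + h * K (tr n) k)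
  (fun=> (1 - gam / 2 * h) * r)).
- move=> k; apply: cvgD; first exact: trx.
  by apply: cvgMl_tmp; exact: birth_death_lim.
- exact: cvg_cst.
- apply: nearW => n; apply: (euler_step_finite (n := n)) => //.
    by move=> k nk; rewrite /tr ltnNge nk.
  split => // [|N]; first by rewrite /tr x0 if_same.
  apply: le_trans (xN N); rewrite !big_seq; apply: ler_sum => k.
  rewrite mem_index_iota => /andP[k0 _].
  apply: ler_wpM2r; first by rewrite ltW // schur_weight_gt0.
  by rewrite /tr; case: ifP => // _; rewrite expr0n sqr_ge0.
Unshelve. all: by end_near. Qed.

End Schur.
End BirthDeath.

(** * Construction of the pairs phi, psi *)

(** Here s stands for the square root of theta, so that psi / phi is comparable to theta^(-k). *)
Definition schur_pair (R : realType) (a : nat -> R) (beta s : R)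
    (phi psi : nat -> R) (gam C : R) :=
  [/\ 0 <= phi 0%N /\ 0 <= psi 0%N,
      forall k, (0 < k)%N -> s ^+ k / C <= phi k <= C * s ^+ k,
      forall k, (0 < k)%N -> s ^- k / C <= psi k <= C * s ^- k,
      forall k, a k * phi k + beta * phi k.+2 <= (a k.+1 + beta - gam) * phi k.+1
    & forall k, a k.+1 * psi k.+2 + beta * psi k <= (a k.+1 + beta - gam) * psi k.+1].

(** The powers of s satisfy both conditions with equality for gam = beta + beta rho - beta s - beta
    rho / s, which factors as the witness and is positive since rho < s < 1. *)
Lemma schur_pair_constant (R : realType) (beta rho s : R) :
  0 < beta -> 0 < s -> s < 1 -> rho < s ->
  exists phi psi gam C, [/\ 0 < gam, 0 < C
    & schur_pair (fun=> beta * rho) beta s phi psi gam C].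
Proof.
move=> beta0 s0 s1 rs.
exists (fun k => s ^+ k), (fun k => s ^- k), (beta * (1 - s) * (1 - rho / s)), 1.
have sn0 : s != 0 by rewrite gt_eqF.
split => //; first by rewrite !mulr_gt0 ?subr_gt0 // ltr_pdivrMr ?mul1r.
split.
- by rewrite !expr0 invr1.
- by move=> k _; rewrite divr1 mul1r lexx.
- by move=> k _; rewrite divr1 mul1r lexx.
- by move=> k; rewrite le_eqVlt; apply/orP; left; apply/eqP; rewrite !exprS; field.
- move=> k; rewrite le_eqVlt; apply/orP; left; apply/eqP; rewrite !exprS.
  by field; rewrite ?expf_neq0 ?sn0.
Qed.

Section SchurPairVanishing.
Variables (R : realType) (beta s : R) (b : nat -> R).
Hypothesis beta_gt0 : 0 < beta.
Hypothesis s_gt0 : 0 < s.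
Hypothesis s_lt1 : s < 1.
Hypothesis b_ge0 : forall k, 0 <= b k.

(** Always s m_i >= 2 b_i, and m_i = 1 as soon as 2 b_i <= s; so the product [Q] stays bounded when
    b is eventually small. *)
Let m i : R := Num.max 1 (2 * b i / s).
Let Q k : R := \prod_(i < k) m i.

(* Chosen so that the net flux [b k * phi_sol k - phi_sol k.+1] is [- s ^+ k],
   which increases with [k] fast enough to make [phi_sol] a supersolution *)
Fixpoint phi_sol k : R := if k is j.+1 then b j * phi_sol j + s ^+ j else 0.
(* The factor [1 / Q j] forces [b j * d j.+1 <= d j / 2] also for the finitely
   many [j] where [b j] is large; [d] is the increment of the dual solution. *)
Let d j : R := s ^- j / Q j.
Let psi k : R := \sum_(j < k.+1) d j.

Let m_ge1 i : 1 <= m i. Proof. by rewrite le_max lexx. Qed.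

Let Q_ge1 k : 1 <= Q k.
Proof.
rewrite /Q; elim: k => [|k ih]; first by rewrite big_ord0.
by rewrite big_ord_recr /= (le_trans ih) // ler_peMr // (le_trans ler01).
Qed.

Let Q_gt0 k : 0 < Q k. Proof. exact: lt_le_trans (Q_ge1 k). Qed.

Let QS k : Q k.+1 = Q k * m k. Proof. by rewrite /Q big_ord_recr. Qed.

Let two_b_le k : 2 * b k <= s * m k.
Proof. by rewrite -ler_pdivrMl // mulrC /m le_max lexx orbT. Qed.

Let Q_bounded k0 k : (forall j, (k0 <= j)%N -> 2 * b j <= s) -> Q k <= Q k0.
Proof.
move=> bs.
have Qmon i j : (i <= j)%N -> Q i <= Q j.
  apply: (homo_leq (r := fun x y => x <= y)) => // [y x z|n]; first exact: le_trans.
  by rewrite QS ler_peMr // ltW.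
case: (leqP k k0) => [|k0k]; first exact: Qmon.
rewrite -(subnK (ltnW k0k)); elim: (k - k0)%N => [|n ih] //.
rewrite addSn QS (_ : m _ = 1) ?mulr1 //.
by apply/max_idPl; rewrite ler_pdivrMr // mul1r bs // leq_addl.
Qed.

Let phi_ge k : s ^+ k <= phi_sol k.+1.
Proof.
rewrite /= lerDr mulr_ge0 //; elim: k => //= k ih.
by rewrite addr_ge0 ?mulr_ge0 ?exprn_ge0 // ltW.
Qed.

(** Induction: 2 b_k / s <= m_k bounds the first summand of the recursion by Q_{k+1} s^k, and
    Q_{k+1} >= 1 bounds the second by the same. *)
Let phi_le k : phi_sol k <= 2 / s * Q k * s ^+ k.
Proof.
elim: k => [|k ih].
  by rewrite /= !mulr_ge0 ?invr_ge0 ?exprn_ge0 // ltW.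
have sk : 0 <= s ^+ k by rewrite exprn_ge0 // ltW.
apply: (@le_trans _ _ (m k * Q k * s ^+ k + Q k * m k * s ^+ k)).
  apply: lerD; last by rewrite ler_peMl // -QS.
  apply: le_trans (ler_wpM2l (b_ge0 k) ih) _.
  rewrite !mulrA; apply: ler_wpM2r => //; apply: ler_wpM2r; first exact: ltW.
  by rewrite ler_pdivrMr // mulrC [m k * s]mulrC.
by rewrite QS exprS le_eqVlt; apply/orP; left; apply/eqP; field; rewrite gt_eqF.
Qed.

Let d_gt0 j : 0 < d j.
Proof. by rewrite divr_gt0 // invr_gt0 exprn_gt0. Qed.

Let d_step k : b k * d k.+1 <= d k / 2.
Proof.
have -> : d k / 2 = d k.+1 * (s * m k) / 2.
  rewrite /d QS exprS; field.
  by rewrite !gt_eqF // ?exprn_gt0 // (lt_le_trans _ (m_ge1 k)).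
rewrite [leLHS]mulrC -mulrA; apply: ler_wpM2l; first by rewrite ltW.
by rewrite ler_pdivlMr // mulrC.
Qed.

Let psi_ge k : d k <= psi k.
Proof.
rewrite /psi big_ord_recr /= lerDr; apply: sumr_ge0 => j _; exact: ltW.
Qed.

Let psiS k : psi k.+1 = psi k + d k.+1.
Proof. by rewrite /psi big_ord_recr. Qed.

Let psi_le k : psi k <= s ^- k / (1 - s).
Proof.
have s1 : 0 < 1 - s by rewrite subr_gt0.
have d_le j : d j <= s ^- j.
  by rewrite ler_pdivrMr // ler_peMr // invr_ge0 exprn_ge0 // ltW.
elim: k => [|k ih].
  rewrite /psi big_ord_recr big_ord0 /= add0r.
  apply: le_trans (d_le 0%N) _; rewrite expr0 invr1 mul1r.
  by rewrite invf_ge1 // gerBl ltW.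
rewrite psiS; apply: (le_trans (lerD ih (d_le k.+1))).
rewrite exprS le_eqVlt; apply/orP; left; apply/eqP; field.
by rewrite !gt_eqF ?exprn_gt0.
Qed.

Lemma schur_pair_vanishing k0 : (forall j, (k0 <= j)%N -> 2 * b j <= s) ->
  exists phi psi gam C, [/\ 0 < gam, 0 < C
    & schur_pair (fun k => beta * b k) beta s phi psi gam C].
Proof.
move=> bs; have QB k := Q_bounded k bs; set B := Q k0 in QB.
have B1 : 1 <= B by exact: Q_ge1.
have s1 : 0 < 1 - s by rewrite subr_gt0.
(* C exceeds the constants of [phi_le] and [psi_le], and also B, since d_k >= s^(-k) / B. *)
pose C := 2 / s * B + (1 - s)^-1.
have is1 : 1 <= s^-1 by rewrite invf_ge1 // ltW.
have i1s : 0 < (1 - s)^-1 by rewrite invr_gt0.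
have BC : B <= C.
  have : B * 1 <= B * s^-1 by rewrite ler_wpM2l // (le_trans ler01).
  rewrite /C; lra.
have C2 : 2 / s * B <= C by rewrite lerDl ltW.
have C3 : (1 - s)^-1 <= C by rewrite lerDr !mulr_ge0 ?invr_ge0 // ltW // (lt_le_trans _ B1).
have C1 : 1 <= C by exact: le_trans BC.
have C0 : 0 < C by exact: lt_le_trans C1.
have phiC k : phi_sol k <= C * s ^+ k.
  apply: le_trans (phi_le k) _; rewrite ler_wpM2r ?exprn_ge0 ?(ltW s_gt0) //.
  by apply: le_trans C2; rewrite ler_wpM2l // divr_ge0 // ltW.
have psiC k : psi k <= C * s ^- k.
  apply: le_trans (psi_le k) _; rewrite mulrC.
  by rewrite ler_wpM2r // invr_ge0 exprn_ge0 // ltW.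
have dC k : s ^- k / C <= d k.
  rewrite ler_wpM2l ?invr_ge0 ?exprn_ge0 ?(ltW s_gt0) //.
  by rewrite lef_pV2 ?posrE // (le_trans (QB k)).
(* One factor C pays for the upper bounds on phi and psi, the other for the lower bound on [d]. *)
pose gam := beta * (1 - s) / (2 * C ^+ 2).
have gam0 : 0 < gam by rewrite divr_gt0 ?mulr_gt0 ?exprn_gt0.
have gamC : gam * C * C = beta * (1 - s) / 2 by rewrite /gam; field; rewrite gt_eqF.
exists phi_sol, psi, gam, C; split => //; split.
- split => //; apply: le_trans (psi_ge 0); exact: ltW.
- case=> // k _; rewrite phiC andbT; apply: le_trans (phi_ge k).
  rewrite ler_pdivrMr // exprS mulrC ler_wpM2l ?exprn_ge0 ?(ltW s_gt0) //.
  by rewrite (le_trans _ C1) // ltW.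
- by move=> k _; rewrite psiC andbT (le_trans (dC k)).
- move=> k.
  (* By the recursion, K phi at k.+1 is exactly - beta s^k (1 - s). *)
  have : gam * phi_sol k.+1 <= beta * (s ^+ k * (1 - s)).
    apply: le_trans (ler_wpM2l (ltW gam0) (phiC k.+1)) _.
    rewrite exprS.
    have -> : beta * (s ^+ k * (1 - s)) = (gam * C * s ^+ k) * (2 * C).
      by rewrite /gam; field; rewrite gt_eqF.
    have -> : gam * (C * (s * s ^+ k)) = (gam * C * s ^+ k) * s by ring.
    apply: ler_wpM2l; last by move: s_lt1 C1; lra.
    apply: mulr_ge0; first by apply: mulr_ge0; exact: ltW.
    by rewrite exprn_ge0 // ltW.
  rewrite /= exprS; lra.
- move=> k; rewrite psiS.
  (* The increments of psi leave beta (b_{k+1} d_{k+2} - d_{k+1}), which [d_step] bounds by - beta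
     d_{k+1} / 2. *)
  have : gam * psi k.+1 <= beta * (d k.+1 / 2).
    apply: le_trans (ler_wpM2l (ltW gam0) (psiC k.+1)) _.
    apply: le_trans (_ : beta / 2 * (s ^- k.+1 / C) <= _); last first.
      by rewrite -mulrA [2^-1 * _]mulrC ler_wpM2l ?(ltW beta_gt0) // ler_wpM2r.
    have -> : gam * (C * s ^- k.+1) = gam * C * C * (s ^- k.+1 / C).
      by field; rewrite ?expf_neq0 ?gt_eqF.
    rewrite gamC; apply: ler_wpM2r.
      by rewrite divr_ge0 ?invr_ge0 ?exprn_ge0 // ltW.
    by rewrite ler_wpM2r // ler_piMr ?(ltW beta_gt0) // gerBl ltW.
  have := ler_wpM2l (ltW beta_gt0) (d_step k.+1).
  rewrite (psiS k); lra.
Qed.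

End SchurPairVanishing.

(** * Well-posedness and decay for birth-death operators *)

Section WeightedBirthDeath.
Variables (R : realType) (a phi psi : nat -> R) (a1 beta s gam C : R).
Hypothesis beta_gt0 : 0 < beta.
Hypothesis a_bounded : forall k, 0 <= a k <= a1.
Hypothesis s_gt0 : 0 < s.
Hypothesis s_lt1 : s < 1.
Hypothesis gam_gt0 : 0 < gam.
Hypothesis C_gt0 : 0 < C.
Hypothesis pair : schur_pair a beta s phi psi gam C.

Let K := birth_death a beta.
Let W k : R := (s ^+ 2) ^- k.
Let w k : R := psi k / phi k.
Let M : R := s^-1 * a1 + (a1 + beta) + beta.

Let W_gt0 k : (0 < k)%N -> 0 < W k.
Proof. by move=> _; rewrite invr_gt0 !exprn_gt0. Qed.

Let phi_gt0 k : (0 < k)%N -> 0 < phi k.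
Proof.
case: pair => _ + _ _ _ k0 => /(_ k k0)/andP[+ _]; apply: lt_le_trans.
by rewrite divr_gt0 ?exprn_gt0.
Qed.

Let psi_gt0 k : (0 < k)%N -> 0 < psi k.
Proof.
case: pair => _ _ + _ _ k0 => /(_ k k0)/andP[+ _]; apply: lt_le_trans.
by rewrite divr_gt0 ?invr_gt0 ?exprn_gt0.
Qed.

Let w_gt0 k : (0 < k)%N -> 0 < w k.
Proof. by move=> k0; rewrite divr_gt0 ?phi_gt0 ?psi_gt0. Qed.

(** Follows from psi <= C s^(-k) and phi >= s^k / C. Together with [W_le_w] it makes the two norms
    equivalent, with factor C in each direction. *)
Let w_le_W k : (0 < k)%N -> w k <= C ^+ 2 * W k.
Proof.
move=> k0; case: pair => _ /(_ k k0)/andP[phil _] /(_ k k0)/andP[_ psiu] _ _.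
have sk : 0 < s ^+ k by rewrite exprn_gt0.
rewrite ler_pdivrMr ?phi_gt0 //; apply: (le_trans psiu).
have -> : C * s ^- k = C ^+ 2 * W k * (s ^+ k / C).
  by rewrite /W exprAC; field; rewrite !gt_eqF.
by rewrite ler_wpM2l // mulr_ge0 ?sqr_ge0 // ltW // W_gt0.
Qed.

Let W_le_w k : (0 < k)%N -> W k <= C ^+ 2 * w k.
Proof.
move=> k0; case: pair => _ /(_ k k0)/andP[_ phiu] /(_ k k0)/andP[psil _] _ _.
have sk : 0 < s ^+ k by rewrite exprn_gt0.
rewrite mulrA ler_pdivlMr ?phi_gt0 //.
apply: (@le_trans _ _ (W k * (C * s ^+ k))).
  by rewrite ler_wpM2l // ltW // W_gt0.
have -> : W k * (C * s ^+ k) = C ^+ 2 * (s ^- k / C).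
  by rewrite /W exprAC; field; rewrite !gt_eqF.
by rewrite ler_wpM2l ?sqr_ge0.
Qed.

Let M_ge0 : 0 <= M.
Proof.
have a10 : 0 <= a1 by case/andP: (a_bounded 0%N); exact: le_trans.
have : 0 <= s^-1 * a1 by rewrite mulr_ge0 // invr_ge0 ltW.
by rewrite /M; move: beta_gt0; lra.
Qed.

Let K_bounded_W x r : bounded_by W x r -> bounded_by W (K x) (M * r).
Proof.
have WS k : W k.+1 = s^-1 ^+ 2 * W k.
  by rewrite /W [(_ ^+ 2) ^+ k.+1]exprS invfM exprVn.
apply: birth_death_bounded => //.
- exact: ltW.
- by rewrite invr_ge0 ltW.
- by move=> k _; rewrite WS.
- move=> k k0; rewrite WS ler_peMl ?(ltW (W_gt0 k0)) //.
  by rewrite exprVn invf_ge1 ?exprn_gt0 // exprn_ile1 // ltW.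
Qed.

Let w_of_W x r : bounded_by W x r -> bounded_by w x (C * r).
Proof. by apply: bounded_by_weight => //; exact: ltW. Qed.

Let W_of_w x r : bounded_by w x r -> bounded_by W x (C * r).
Proof. by apply: bounded_by_weight => //; exact: ltW. Qed.

Let K_bounded_w x r : bounded_by w x r -> bounded_by w (K x) (C * M * C * r).
Proof. by move=> /W_of_w/K_bounded_W/w_of_W; rewrite !mulrA. Qed.

(** Small enough for both step conditions of [euler_step], C M C being the bound of K for [w]; the
    added 1 keeps the denominator positive. *)
Let h0 : R := Num.min (2 * gam)^-1 (gam / ((C * M * C) ^+ 2 + 1)).

Let h0_gt0 : 0 < h0.
Proof.
by rewrite lt_min invr_gt0 mulr_gt0 //= divr_gt0 // ltr_wpDl ?sqr_ge0.
Qed.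

Let K_euler_step h x q : 0 <= h <= h0 -> bounded_by w x q ->
  bounded_by w (fun k => x k + h * K x k) ((1 - 2 * (gam / 4) * h) * q).
Proof.
rewrite le_min => /and3P[h_ge0 h1 h2].
(* The abstract decay argument takes the contraction as 2 g h, hence g = gam / 4. *)
have -> : 2 * (gam / 4) = gam / 2 by field.
case: pair => -[phi0 psi0] _ _ sphi spsi.
apply: (euler_step _ _ _ _ _ _ sphi spsi gam_gt0 K_bounded_w) => //.
- exact: ltW.
- by move=> k; case/andP: (a_bounded k).
- by rewrite mulrC -ler_pdivlMr ?mulr_gt0 // mul1r.
- have D0 : 0 < (C * M * C) ^+ 2 + 1 by rewrite ltr_wpDl ?sqr_ge0.
  move: h2; rewrite ler_pdivlMr // mulrDr mulr1; lra.
Qed.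

Definition has_derivative (y : R -> nat -> R) :=
  forall t e : R, 0 <= t -> 0 < e ->
  exists2 d, 0 < d & forall u : R, 0 <= u -> u != t -> `|u - t| < d ->
    bounded_by w (fun k => (y u k - y t k) / (u - t) - K (y t) k) e.

Lemma L2g_sub x y : L2g (s ^+ 2) x -> L2g (s ^+ 2) y ->
  L2g (s ^+ 2) (fun k => x k - y k).
Proof.
have t0 : 0 < s ^+ 2 by rewrite exprn_gt0.
move=> /(L2g_bounded_by t0) x_ /(L2g_bounded_by t0) y_.
by apply: (bounded_by_L2g t0 (bounded_by_sub _ x_ y_)).
Qed.

Lemma L2g_scale x c : L2g (s ^+ 2) x -> L2g (s ^+ 2) (fun k => x k * c).
Proof.
have t0 : 0 < s ^+ 2 by rewrite exprn_gt0.
move=> /(L2g_bounded_by t0) /(bounded_by_scale c) /(bounded_by_L2g t0).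
by congr L2g; apply/funext => k; rewrite mulrC.
Qed.

Lemma solution_has_derivative z0 y :
  is_L2g_solution (s ^+ 2) K z0 y -> has_derivative y.
Proof.
have th0 : 0 < s ^+ 2 by rewrite exprn_gt0.
move=> [_ yL yd] t e t0 e0.
have eC : 0 < e / C by rewrite divr_gt0.
have /cvgr0Pnorm_lt /(_ _ eC) := yd t t0.
rewrite /= => -[d /= d0 dP]; exists d => // u u0 ut ud.
have := dP u; rewrite /= distrC => /(_ ud ut u0) lt_e.
(* A small [L2g_norm] is informative only for a sequence in L_2(g_theta), because of the default of
   [fine]; so the membership of all terms is collected first. *)
have [yt Kyt] := yL t t0; have [yu _] := yL u u0.
have := L2g_bounded_by th0 (L2g_sub (L2g_scale (u - t)^-1 (L2g_sub yu yt)) Kyt).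
move=> /w_of_W; apply: bounded_by_le.
rewrite mulrC -ler_pdivlMr //; apply: le_trans (ltW lt_e).
exact: ler_norm.
Qed.

Lemma has_derivative_sub y z : has_derivative y -> has_derivative z ->
  has_derivative (fun t k => y t k - z t k).
Proof.
move=> yd zd t e t0 e0; have e20 : 0 < e / 2 by rewrite divr_gt0.
have [d1 d10 d1P] := yd t _ t0 e20; have [d2 d20 d2P] := zd t _ t0 e20.
exists (Num.min d1 d2); first by rewrite lt_min d10.
move=> u u0 ut; rewrite lt_min => /andP[ud1 ud2].
have := bounded_by_sub w_gt0 (d1P u u0 ut ud1) (d2P u u0 ut ud2).
have -> : e / 2 + e / 2 = e by field.
congr bounded_by; apply/funext => k.
rewrite (_ : (fun k => y t k - z t k) = fun k => y t k + -1 * z t k).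
  rewrite /K birth_death_linear; field.
  by rewrite subr_eq0.
by apply/funext => j; rewrite mulN1r.
Qed.

(** One factor C is for passing from [W] to [w] at time 0, the other for the way back at time t. *)
Lemma has_derivative_decay y r t : has_derivative y ->
  (forall t, 0 <= t -> L2g (s ^+ 2) (y t)) ->
  bounded_by W (y 0) r -> 0 <= t ->
  bounded_by W (y t) (C * (expR (- (gam / 4 * t)) * (C * r))).
Proof.
have th0 : 0 < s ^+ 2 by rewrite exprn_gt0.
move=> yd yL y0 t0; apply: W_of_w.
apply: (solution_decay w_gt0 K_bounded_w _ h0_gt0 K_euler_step _ yd (w_of_W y0) t0).
  by rewrite divr_gt0.
move=> u u0; exists (C * L2g_norm (s ^+ 2) (y u)).
by apply: w_of_W; apply: L2g_bounded_by => //; exact: yL.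
Qed.

Lemma op_exp_solution z0 : L2g (s ^+ 2) z0 ->
  is_L2g_solution (s ^+ 2) K z0 (fun t => op_exp K t z0).
Proof.
have th0 : 0 < s ^+ 2 by rewrite exprn_gt0.
move=> /(L2g_bounded_by th0) zb.
have linK := birth_death_linear a beta; have limK := @birth_death_lim _ a beta.
have expb t (t0 : 0 <= t) := op_exp_bounded W_gt0 M_ge0 K_bounded_W t0 zb.
split.
- exact: (op_exp0 W_gt0 M_ge0 K_bounded_W zb).
- move=> t t0; split; first exact: (bounded_by_L2g th0 (expb t t0)).
  exact: (bounded_by_L2g th0 (K_bounded_W (expb t t0))).
- move=> t t0.
  apply: (@squeeze_cvgr _ _ _ _ (fun=> 0)
    (fun u => `|exp_diff M t u| * L2g_norm (s ^+ 2) z0)).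
  + rewrite near_withinE /dnbhs near_withinE; apply: nearW => u ut u0.
    rewrite L2g_norm_ge0 /=; apply: L2g_norm_le => //.
    exact: (op_exp_diff_bounded W_gt0 linK limK M_ge0 K_bounded_W).
  + exact: cvg_cst.
  + rewrite -[X in _ --> X](mul0r (L2g_norm (s ^+ 2) z0)); apply: cvgMr_tmp.
    rewrite -[X in _ --> X](@normr0 _ R); apply: cvg_norm.
    apply: cvg_trans (exp_diff_cvg0 M t).
    by apply: cvg_app; exact: cvg_within.
Unshelve. all: by end_near. Qed.

Lemma op_exp_is_L2g_exp z0 t : L2g (s ^+ 2) z0 -> 0 <= t ->
  is_L2g_exp (s ^+ 2) K t z0 (op_exp K t z0).
Proof.
have th0 : 0 < s ^+ 2 by rewrite exprn_gt0.
move=> /(L2g_bounded_by th0) zb t0.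
split.
- move=> N; apply: (bounded_by_L2g th0).
  exact: (op_sum_bounded W_gt0 K_bounded_W (exp_coeff t) N zb).
- apply: (bounded_by_L2g th0).
  exact: (op_exp_bounded W_gt0 M_ge0 K_bounded_W t0 zb).
apply: (@squeeze_cvgr _ _ _ _ (fun=> 0) (fun N =>
  (expR (t * M) - series (exp_coeff (t * M)) N) * L2g_norm (s ^+ 2) z0)).
- near=> N; rewrite L2g_norm_ge0 /=; apply: L2g_norm_le => //.
  exact: (op_exp_tail_bounded W_gt0 M_ge0 K_bounded_W N t0 zb).
- exact: cvg_cst.
- rewrite -[X in _ --> X](mul0r (L2g_norm (s ^+ 2) z0)); apply: cvgMr_tmp.
  rewrite -[X in _ --> X](subrr (expR (t * M))); apply: cvgB; first exact: cvg_cst.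
  exact: series_exp_coeff_cvg.
Unshelve. all: by end_near. Qed.

Lemma birth_death_decay z0 : L2g (s ^+ 2) z0 ->
  exists z : R -> nat -> R,
    [/\ is_L2g_solution (s ^+ 2) K z0 z,
        forall y, is_L2g_solution (s ^+ 2) K z0 y ->
          forall t, 0 <= t -> y t = z t,
        forall t, 0 <= t -> is_L2g_exp (s ^+ 2) K t z0 (z t)
      & forall t, 0 <= t -> L2g_norm (s ^+ 2) (z t)
          <= expR (- (gam / 4 * t)) * C ^+ 2 * L2g_norm (s ^+ 2) z0].
Proof.
have th0 : 0 < s ^+ 2 by rewrite exprn_gt0.
move=> z0L; have zsol := op_exp_solution z0L.
exists (fun t => op_exp K t z0).
have [z00 zL _] := zsol; have zd := solution_has_derivative zsol.
split => //.
- move=> y ysol t t0; have [y0 yL _] := ysol.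
  have yd := solution_has_derivative ysol.
  (* The difference of two solutions starts at 0, hence is bounded by 0 at all times. *)
  have := has_derivative_decay (has_derivative_sub yd zd) (r := 0) _ _ t0.
  rewrite !mulr0 => h; apply/funext => k; apply/subr0_eq.
  suff e : (fun k => y t k - op_exp K t z0 k) = fun=> 0.
    exact: (congr1 (@^~ k) e).
  apply: (bounded_by_eq0 W_gt0); apply: h.
    by move=> u u0; apply: L2g_sub; [case: (yL u u0)|case: (zL u u0)].
  rewrite y0 z00 (_ : (fun k => _) = fun=> 0); first exact: bounded_by0.
  by apply/funext => j; rewrite subrr.
- by move=> t t0; exact: op_exp_is_L2g_exp.
- move=> t t0; rewrite (_ : _ * _ = C * (expR (- (gam / 4 * t)) *
     (C * L2g_norm (s ^+ 2) z0))); last by ring.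
  apply: L2g_norm_le => //; apply: (has_derivative_decay zd) => //.
    by move=> u u0; case: (zL u u0).
  by rewrite z00; exact: L2g_bounded_by.
Qed.

End WeightedBirthDeath.

(** * The rates of K and the conclusion *)

(** Since j < L^j for L >= 2, rho^(L^j) is at most rho^j, which tends to 0. *)
Lemma geometric_rate_vanishing (R : realType) (rho s : R) (L : nat) :
  0 < rho < 1 -> 0 < s -> (2 <= L)%N ->
  exists k0, forall j, (k0 <= j)%N -> 2 * (L%:R * rho ^+ (L ^ j)) <= s.
Proof.
move=> /andP[rho0 rho1] s0 L2.
have LL : 0 < L%:R :> R by rewrite ltr0n ltnW.
have e0 : 0 < s / (2 * L%:R) by rewrite divr_gt0 ?mulr_gt0.
have rho_cvg : rho ^+ n @[n --> \oo] --> 0 by apply: cvg_expr; rewrite gtr0_norm.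
have /cvgr0Pnorm_lt /(_ _ e0)[k0 _ k0P] := rho_cvg.
exists k0 => j k0j; have := k0P j k0j; rewrite /= gtr0_norm ?exprn_gt0 // => rj.
rewrite mulrA -ler_pdivlMl ?mulr_gt0 // mulrC.
apply: le_trans (ltW rj); rewrite ler_wiXn2l ?(ltW rho0) ?(ltW rho1) //.
by rewrite ltnW // ltn_expl.
Qed.

Theorem theorem2p10 (R : realType) (alpha beta rho theta : R) (L : nat)
    (halpha : 0 < alpha) (hbeta : alpha < beta) (hrho : rho = alpha / beta)
    (hL : (1 <= L)%N)
    (htheta : (2 <= L)%N /\ 0 < theta < 1 \/ L = 1%N /\ rho <= theta < 1) :
  exists gamma C : R, 0 < gamma /\
    forall z0 : nat -> R, L2g theta z0 ->
      exists z : R -> nat -> R,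
        [/\ is_L2g_solution theta (calK beta rho L) z0 z,
            forall y : R -> nat -> R,
              is_L2g_solution theta (calK beta rho L) z0 y ->
              forall t : R, 0 <= t -> y t = z t,
            forall t : R, 0 <= t ->
              is_L2g_exp theta (calK beta rho L) t z0 (z t)
          & forall t : R, 0 <= t ->
              L2g_norm theta (z t)
                <= expR (- (gamma * t)) * C * L2g_norm theta z0].
Proof.
have beta0 : 0 < beta by exact: lt_trans hbeta.
have rho0 : 0 < rho by rewrite hrho divr_gt0.
have rho1 : rho < 1 by rewrite hrho ltr_pdivrMr // mul1r.
have [th0 th1] : 0 < theta /\ theta < 1.
  case: htheta => -[_ /andP[]] // rt t1; split=> //; exact: lt_le_trans rt.
pose s := Num.sqrt theta.
have s0 : 0 < s by rewrite sqrtr_gt0.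
have s1 : s < 1 by rewrite -sqrtr1 ltr_sqrt.
have ths : theta = s ^+ 2 by rewrite sqr_sqrtr // ltW.
pose a j := beta * (L%:R * rho ^+ (L ^ j)).
have calKE : calK beta rho L = birth_death a beta.
  by apply/funext => x; apply/funext => -[|k] //=; rewrite /a !mulrA.
have a_bounded k : 0 <= a k <= beta * L%:R.
  have rk : 0 <= rho ^+ (L ^ k) by rewrite exprn_ge0 // ltW.
  rewrite /a !mulr_ge0 ?(ltW beta0) //= ler_wpM2l ?(ltW beta0) //.
  by rewrite ler_piMr // exprn_ile1 // ltW.
have [phi [psi [gam [C [gam0 C0 pair]]]]] :
    exists phi psi gam C, [/\ 0 < gam, 0 < C & schur_pair a beta s phi psi gam C].
  case: htheta => -[hL' hth].
    have [|k0 k0P] := @geometric_rate_vanishing R rho s L _ s0 hL'.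
      by rewrite rho0.
    apply: (schur_pair_vanishing beta0 s0 s1 _ k0P) => k.
    by rewrite mulr_ge0 // exprn_ge0 // ltW.
  have -> : a = fun=> beta * rho.
    by apply/funext => j; rewrite /a hL' exp1n expr1 mul1r.
  apply: schur_pair_constant => //.
  (* Here rho <= theta = s^2 < s, so the endpoint theta = rho still gives the strict inequality. *)
  case/andP: hth => rt _; apply: (le_lt_trans rt).
  by rewrite ths expr2 gtr_pMl.
exists (gam / 4), (C ^+ 2); split; first by rewrite divr_gt0.
rewrite calKE ths => z0 z0L.
exact: (birth_death_decay beta0 a_bounded s0 s1 gam0 C0 pair z0L).
Qed.
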